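(* Let $c=c(x)$ be a smooth function, $D=\frac{\mathrm d}{\mathrm dx}$ and $c_i=D^ic$. For $n\ge1$, $$(c^2D)^nc=\sum_{p\in\overline{\mathrm{OWP}}_n}w(p).$$ Moreover, $$(c^2D)^nc=\sum_{T\in\mathrm{SYT}(n)}\left(\prod_{i=1}^n\delta_i(T)\,c_i^{w_i(T)}\right)c^{2n+1-\ell(\lambda(T))},$$ where $$\delta_i(T)=\begin{cases}2i-\mathrm{col}_1(T_i), & \text{if } i \text{ is in the first column of } T,\\ \mathrm{col}_k(T_i)-\mathrm{col}_{k+1}(T_i)+1, & \text{if } i \text{ is in the } (k+1)\text{-th column of } T,\ k\ge1.\end{cases}$$
   Context: $(c^2D)^nc$ denotes the result of applying $n$ times to the function $c$ the operator $f\mapsto c^2f'$. $\overline{\mathrm{OWP}}_n$ is the set of lists $(B_0,B_1,\overline B_1,B_2,\overline B_2,\dots,B_n,\overline B_n)$ of $2n+1$ pairwise disjoint (possibly empty) subsets of $[n]$ with union $[n]$ such that (a) $1\in B_0$; (b) for $1\le i\le n$, if $B_i$ (respectively $\overline B_i$) is nonempty, then its minimum element is larger than $i$. The weight of $p\in\overline{\mathrm{OWP}}_n$ is $w(p)=\prod_{B}c_{|B|}$, the product over all $2n+1$ blocks $B$ of $p$, where $c_0=c$. A standard Young tableau of size $n$ is a filling of the Ferrers diagram of a partition $\lambda\vdash n$ (French convention: left-justified rows numbered from bottom to top, $\lambda_i$ boxes in row $i$) with $1,\dots,n$, each used exactly once, increasing from left to right in rows and from bottom to top in columns; $\mathrm{SYT}(n)$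 is the set of all of them, over all $\lambda\vdash n$. For $T\in\mathrm{SYT}(n)$, $\ell(\lambda(T))$ is the number of rows of $T$, $w_i(T)$ is the number of rows of $T$ with exactly $i$ boxes, $T_i$ is the tableau obtained from $T$ by deleting the entries $i+1,\dots,n$, and $\mathrm{col}_k(T_i)$ is the number of boxes in the $k$-th column of $T_i$. *)

(* Defs.v *)
From HB Require Import structures.
From mathcomp Require Import all_boot all_order all_algebra.
From mathcomp Require Import all_classical all_reals all_analysis.

Set Implicit Arguments.
Unset Strict Implicit.
Unset Printing Implicit Defensive.

Import Order.TTheory GRing.Theory Num.Theory.
Import numFieldNormedType.Exports.

Local Open Scope ring_scope.
Local Open Scope classical_set_scope.

(* To be used with [U] open, so that each iterated derivative at a point of [U]
   depends only on the values of [c] on [U]. *)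
Definition smooth_on (R : realType) (U : set R) (c : R -> R) : Prop :=
  forall (k : nat) (x : R), U x -> derivable (derive1n k c) x 1.

Definition c2D (R : realType) (c f : R -> R) : R -> R :=
  fun x => c x ^+ 2 * derive1 f x.

(* Ordinals are 0-based: [j : 'I_n] stands for the element [lab j] of
   [n] = {1, ..., n}. *)
Definition lab (n : nat) (j : 'I_n) : nat := j.+1.

(* Positions of the 2n+1 blocks: [None] is the position of B_0, and
   [Some (i, false)], [Some (i, true)] are those of B_(lab i) and of
   \overline B_(lab i). *)
Definition block_pos (n : nat) := option ('I_n * bool).

Definition block_list (n : nat) := {ffun block_pos n -> {set 'I_n}}.

(* The minimum of a nonempty block exceeds lab i iff all its elements do; this
   also covers the empty block, on which there is no constraint. *)
Definition is_OWPbar (n : nat) (p : block_list n) : bool :=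
  [&& [forall a, forall b, (a != b) ==> [disjoint p a & p b]],
      (\bigcup_a p a)%SET == [set: 'I_n]%SET,
      [exists j in p None, lab j == 1%N]
    & [forall i, forall b, forall j in p (Some (i, b)), (lab i < lab j)%N]].

Definition OWPbar (n : nat) : {set block_list n} :=
  [set p | is_OWPbar p]%SET.

(* c_0 = c is the 0-th derivative, so empty blocks contribute a factor c. *)
Definition OWP_weight (R : realType) (c : R -> R) (n : nat)
    (p : block_list n) (x : R) : R :=
  \prod_(a : block_pos n) derive1n #|p a| c x.

(* Partitions of n as weakly decreasing sequences of length n padded with
   zeros. *)
Definition is_partn (n : nat) (lam : {ffun 'I_n -> 'I_n.+1}) : bool :=
  ((\sum_(r < n) lam r)%N == n) &&
  [forall r : 'I_n, forall s : 'I_n, (r <= s)%N ==> (lam s <= lam r)%N].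

(* The cell (r, k) lies in row [lab r], counted from the bottom, and in column
   [lab k], counted from the left. The value 0 marks a cell outside the
   diagram; the values 1, ..., n are entries. *)
Definition filling (n : nat) := {ffun 'I_n * 'I_n -> 'I_n.+1}.

Definition is_box (n : nat) (T : filling n) (x : 'I_n * 'I_n) : bool :=
  (0 < T x)%N.

Definition is_SYT_of (n : nat) (lam : {ffun 'I_n -> 'I_n.+1})
    (T : filling n) : bool :=
  [&& [forall r, forall k, is_box T (r, k) == (lab k <= lam r)%N],
      [forall i : 'I_n.+1, (0 < i)%N ==> (#|[set x | T x == i]%SET| == 1%N)],
      [forall r, forall k, forall k',
        [&& is_box T (r, k), is_box T (r, k') & (k < k')%N] ==>
        (T (r, k) < T (r, k'))%N]
    & [forall k, forall r, forall r',
        [&& is_box T (r, k), is_box T (r', k) & (r < r')%N] ==>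
        (T (r, k) < T (r', k))%N]].

Definition SYT (n : nat) : {set filling n} :=
  [set T | [exists lam, is_partn lam && is_SYT_of lam T]]%SET.

Definition row_size (n : nat) (T : filling n) (r : 'I_n) : nat :=
  #|[set k | is_box T (r, k)]%SET|.

Definition num_rows (n : nat) (T : filling n) : nat :=
  #|[set r | (0 < row_size T r)%N]%SET|.

(* Meaningful for 1 <= i only: rows of size 0 are not rows of the diagram. *)
Definition rows_of_size (n : nat) (i : nat) (T : filling n) : nat :=
  #|[set r | row_size T r == i]%SET|.

(* T_i: the cells of the deleted entries become cells outside the diagram. *)
Definition entries_le (n : nat) (i : nat) (T : filling n) : filling n :=
  [ffun x => if (T x <= i)%N then T x else ord0].

(* Columns are numbered from 1. *)
Definition col_size (n : nat) (k : nat) (T : filling n) : nat :=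
  #|[set x : 'I_n * 'I_n | is_box T x && (lab x.2 == k)]%SET|.

(* The (1-based) column of [T] containing the entry [i]; 0 if there is none. *)
Definition col_of (n : nat) (i : nat) (T : filling n) : nat :=
  if [pick x | is_box T x && (T x == i :> nat)] is Some x then lab x.2 else 0%N.

(* The second branch is indexed by the column m = k + 1 containing [i]. *)
Definition delta (n : nat) (i : nat) (T : filling n) : int :=
  let m := col_of i T in
  if m == 1%N then (2 * i)%:Z - (col_size 1 (entries_le i T))%:Z
  else (col_size m.-1 (entries_le i T))%:Z - (col_size m (entries_le i T))%:Z + 1.

(* The exponent 2n+1-l is not truncated, as a tableau of size n has at most n
   rows. *)
Definition SYT_term (R : realType) (c : R -> R) (n : nat)
    (T : filling n) (x : R) : R :=
  (\prod_(1 <= i < n.+1) ((delta i T)%:~R * derive1n i c x ^+ rows_of_size i T)) *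
  c x ^+ (2 * n + 1 - num_rows T).

(* Main.v *)
Require Import Defs.
From HB Require Import structures.
From mathcomp Require Import all_boot all_order all_algebra.
From mathcomp Require Import all_classical all_reals all_analysis.
From mathcomp Require Import zify.
Import Order.TTheory GRing.Theory Num.Theory.
Import numFieldNormedType.Exports.
Local Open Scope ring_scope.
Local Open Scope classical_set_scope.

(** Write [c_i] for the [i]-th derivative of [c]. Every iterate of [f |-> c ^ 2 f']
    on [c] is a sum of products of [2 m + 1] factors [c_k], where [m] is the number
    of iterations. Such a product is regarded as a list of [2 m + 1] blocks, the
    factor [c_k] standing for a block of size [k]. By the Leibniz rule one further
    application of the operator chooses a block, adds the element [m + 1] to it
    (its factor [c_k] becomes [c_(k+1)]), and contributes two new empty blocks
    through the factor [c ^ 2]. Recording the choices yields exactly the lists of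
    blocks in which element [j] lies in [B_0] or in a block of index less than [j]
    ([iter_c2D_words], [OWPbar_words]).

    For tableaux, only the size [k] of the chosen block is recorded. The sizes of
    the nonempty blocks form a partition, and the step adds a box in column
    [k + 1] of its diagram; a sequence of such steps is a standard Young tableau,
    and it arises in as many ways as the product, over the steps, of the number of
    blocks of size [k] at that time. This is the product of the [delta_i].

    A tableau is handled as the word of the columns of its entries. The recursion
    produces a sum over all words of columns on which no step is impossible
    ([iter_c2D_columns]); these are the lattice words, those for which the column
    heights stay weakly decreasing. Stacking the entries on the columns named by
    the letters is a bijection from lattice words to standard Young tableaux
    ([fill_SYT], [SYT_fills]) that matches the two weights ([SYT_term_fills]). *)

(** * Sums over words *)

(** Lets a sum over admissible words be grown one letter at a time, matching one
    application of the operator. *)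
Lemma big_tuple_rcons (S : nmodType) (A : finType) (m : nat)
    (P : pred (seq A)) (Q : seq A -> pred A) (G : seq A -> S)
    (hPQ : forall (t : m.-tuple A) a, P (rcons t a) = P t && Q t a) :
  \sum_(t : m.+1.-tuple A | P t) G t =
  \sum_(t : m.-tuple A | P t) \sum_(a | Q t a) G (rcons t a).
Proof.
rewrite pair_big_dep /=.
pose h (p : m.-tuple A * A) : m.+1.-tuple A := [tuple of rcons p.1 p.2].
pose h' (t : m.+1.-tuple A) : m.-tuple A * A :=
  ([tuple of belast (thead t) (behead t)], last (thead t) (behead t)).
have h'K : cancel h' h.
  by move=> t; apply: val_inj => /=; rewrite -lastI; case/tupleP: t.
have hK : cancel h h'.
  have h_inj : injective h.
    move=> [t a] [u b] /(congr1 val) /= /rcons_inj [tu ->].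
    by congr pair; apply: val_inj.
  by move=> p; apply: h_inj; rewrite h'K.
rewrite (reindex h) /=; last exact: onW_bij (Bijective hK h'K).
by apply: eq_bigl => -[t a]; exact: hPQ.
Qed.

Lemma big_tuple0 {S : nmodType} {A : finType} {P : pred (seq A)} (G : seq A -> S) :
  P [::] -> \sum_(t : 0.-tuple A | P t) G t = G [::].
Proof.
move=> P0; rewrite (big_pred1 [tuple]) // => t.
by rewrite tuple0 /= eqxx P0.
Qed.

Lemma count_mem_rcons {T : eqType} (s : seq T) (a b : T) :
  count_mem b (rcons s a) = (count_mem b s + (a == b))%N.
Proof. by rewrite -cats1 count_cat /= addn0. Qed.

(** * Leibniz rule and differentiation on an open set *)

Lemma is_derive_prod {R : realType} {I : finType} {P : pred I}
    {F : I -> R -> R} {dF : I -> R} {y : R} :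
  (forall i, is_derive y 1 (F i) (dF i)) ->
  is_derive y 1 (fun z => \prod_(i | P i) F i z)
    (\sum_(i | P i) dF i * \prod_(j | P j && (j != i)) F j y).
Proof.
move=> HF; elim: (index_enum I) (index_enum_uniq I) => [_|a r IHr].
  rewrite big_nil; under [X in is_derive _ _ X]funext do rewrite big_nil.
  exact: is_derive_cst.
case/andP => ar /IHr {}IHr.
have [Pa|Pa] := boolP (P a); last first.
  under [X in is_derive _ _ X]funext do rewrite big_cons (negbTE Pa).
  rewrite big_cons (negbTE Pa); apply: is_derive_eq; apply: eq_bigr => i _.
  by rewrite big_cons (negbTE Pa).
have -> : (fun z => \prod_(i <- a :: r | P i) F i z) =
   F a * (fun z => \prod_(i <- r | P i) F i z).
  by apply/funext => z; rewrite big_cons Pa.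
apply: is_derive_eq.
rewrite big_cons Pa big_cons Pa eqxx /= addrC; congr (_ + _).
  rewrite /GRing.scale /= mulrC; congr (_ * _).
  rewrite [LHS]big_seq_cond [RHS]big_seq_cond; apply: eq_bigl => i.
  by have [ir|] := boolP (i \in r) => //=; case: eqP ir ar => [->->|] //; rewrite andbT.
rewrite /GRing.scale /= big_distrr /= [LHS]big_seq_cond [RHS]big_seq_cond.
apply: eq_bigr => i /andP[ir _].
rewrite big_cons Pa; case: eqP => [ai|_] /=; first by move: ar; rewrite ai ir.
by rewrite mulrCA.
Qed.

Lemma is_derive_exp {R : realType} {F : R -> R} {dF y : R} (e : nat) :
  is_derive y 1 F dF ->
  is_derive y 1 (fun z => F z ^+ e) (e%:R * F y ^+ e.-1 * dF).
Proof.
move=> HF; have -> : (fun z => F z ^+ e) = F ^+ e.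
  by apply/funext => z; elim: e => [//|e IHe]; rewrite !exprS IHe.
exact: is_deriveX.
Qed.

Lemma is_derive_sum_fin {R : realType} {I : finType} {P : pred I}
    {F : I -> R -> R} {dF : I -> R} {y : R} :
  (forall i, P i -> is_derive y 1 (F i) (dF i)) ->
  is_derive y 1 (fun z => \sum_(i | P i) F i z) (\sum_(i | P i) dF i).
Proof.
move=> HF; elim: (index_enum I) => [|a r IHr].
  rewrite big_nil; under [X in is_derive _ _ X]funext do rewrite big_nil.
  exact: is_derive_cst.
have [Pa|Pa] := boolP (P a); last first.
  under [X in is_derive _ _ X]funext do rewrite big_cons (negbTE Pa).
  by rewrite big_cons (negbTE Pa).
have -> : (fun z => \sum_(i <- a :: r | P i) F i z) =
   F a + (fun z => \sum_(i <- r | P i) F i z).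
  by apply/funext => z; rewrite big_cons Pa.
by rewrite big_cons Pa; apply: is_deriveD => //; exact: HF.
Qed.

Lemma is_derive_derive1n {R : realType} {U : set R} {c : R -> R} {y : R} (k : nat) :
  smooth_on U c -> U y ->
  is_derive y 1 (derive1n k c) (derive1n k.+1 c y).
Proof.
by move=> hc Uy; rewrite derive1nS derive1E; apply: DeriveDef => //; exact: hc.
Qed.

(** Openness makes the derivative at a point of [U] depend only on the values on
    [U], so an identity known on [U] may be differentiated. *)
Lemma c2D_eq_on {R : realType} {U : set R} {c f g : R -> R} {y dg : R} :
  open U -> (forall z, U z -> f z = g z) -> U y -> is_derive y 1 g dg ->
  c2D c f y = c y ^+ 2 * dg.
Proof.
move=> oU fg Uy [_ <-]; rewrite /c2D derive1E; congr (_ * _).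
apply: near_eq_derive; near=> z; apply: fg; near: z.
exact: open_nbhs_nbhs.
Unshelve. all: by end_near. Qed.

(** * Expansion over ordered lists of blocks *)

(** The positions available after [m] steps: [B_0] and the pairs numbered at most
    [m]. With 0-based ordinals, element [lab j] may enter position [a] iff
    [active j a]; for [j = 0] this leaves only [B_0], which is condition (a). *)
Definition active {n : nat} (m : nat) (a : block_pos n) : bool :=
  if a is Some (i, _) then (i < m)%N else true.

(** A list of blocks is encoded as the word whose letter number [j] is the position
    of the block containing [lab j]. *)
Definition admissible {n : nat} (t : seq (block_pos n)) : bool :=
  all (fun j => active j (nth None t j)) (iota 0 (size t)).

Lemma admissible_rcons {n : nat} (t : seq (block_pos n)) a :
  admissible (rcons t a) = admissible t && active (size t) a.
Proof.
rewrite /admissible size_rcons -addn1 iotaD all_cat /= add0n andbT nth_rcons ltnn eqxx.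
congr (_ && _); apply: eq_in_all => j; rewrite mem_iota add0n => /andP[_ jt].
by rewrite nth_rcons jt.
Qed.

Lemma count_mem_inactive {n m : nat} {t : seq (block_pos n)} {a : block_pos n} :
  admissible t -> (size t <= m)%N -> ~~ active m a -> count_mem a t = 0%N.
Proof.
elim/last_ind: t => [//|t b IHt]; rewrite admissible_rcons size_rcons => /andP[at_ ab] tm am.
rewrite count_mem_rcons IHt //; last exact: ltnW.
case: eqP => // ba; move: am; rewrite -ba.
by case: b ab {ba} => [[i ?]|] //= it; rewrite (ltn_trans it).
Qed.

(** One step of the recursion: by Leibniz, the derivative chooses an active block
    and increments its size, which is the choice of a next letter; the factor
    [c ^ 2] supplies the two empty blocks that become active. *)
Lemma iter_c2D_words {R : realType} {U : set R} {c : R -> R} {n m : nat} {y : R} :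
  open U -> smooth_on U c -> (m <= n)%N -> U y ->
  iter m (c2D c) c y =
  \sum_(t : m.-tuple (block_pos n) | admissible t)
    \prod_(a | active m a) derive1n (count_mem a t) c y.
Proof.
move=> oU hc; elim: m y => [|m IHm] y mn Uy.
  rewrite (big_tuple0 (fun t => \prod_(a | active 0 a) derive1n (count_mem a t) c y)) //.
  by rewrite (big_pred1 None) // => -[[]|].
rewrite (@big_tuple_rcons _ _ _ _ (fun t => active (size t))
  (fun t => \prod_(a | active m.+1 a) derive1n (count_mem a t) c y)); last first.
  by move=> t a; exact: admissible_rcons.
have {}IHm z : U z -> _ := IHm z (ltnW mn).
have der (t : m.-tuple (block_pos n)) := is_derive_prod (P := active m)
  (fun a => is_derive_derive1n (count_mem a t) hc Uy).
rewrite iterS (c2D_eq_on oU IHm Uy (is_derive_sum_fin (fun t _ => der t))).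
rewrite big_distrr /=; apply: eq_bigr => t at_.
rewrite size_tuple big_distrr /=; apply: eq_bigr => a am.
(* [i] is the index of the pair of blocks that becomes active at this step. *)
pose i := Ordinal mn.
rewrite [RHS](bigD1 (Some (i, false))) /= ?ltnSn //.
rewrite [X in _ = _ * X](bigD1 (Some (i, true))) /= ?ltnSn; last by apply/eqP => -[].
have c0 b : derive1n (count_mem (Some (i, b)) (rcons t a)) c y = c y.
  rewrite count_mem_rcons (count_mem_inactive (m := m) at_) ?size_tuple //= ?ltnn //.
  by case: eqP am => [->|//]; rewrite /= ltnn.
rewrite !c0 expr2 -!mulrA; do 2!congr (_ * _).
rewrite [RHS](bigD1 a) /=; last first.
  case: a am {c0} => [[j b]|] //= jm; rewrite ltnS (ltnW jm) /=.
  by apply/andP; split; apply/eqP => -[ji _]; move: jm; rewrite ji ltnn.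
rewrite count_mem_rcons eqxx addn1; congr (_ * _).
apply: eq_big => [b|b /andP[_ ba]]; last first.
  by rewrite count_mem_rcons eq_sym (negbTE ba) addn0.
congr (_ && _); case: b => [[j b]|] //=.
have neq b' : (Some (j, b) != Some (i, b') :> block_pos n) = (j != m :> nat) || (b != b').
  by rewrite -negb_and.
by rewrite !neq ltnS; case: b {neq}; rewrite /= ?orbT ?orbF ?andbT; lia.
Qed.

Lemma card_tnth_count {n : nat} {A : eqType} (t : n.-tuple A) (a : A) :
  #|[set j | tnth t j == a]%SET| = count_mem a t.
Proof.
rewrite cardsE cardE /enum_mem size_filter -enumT -[in RHS](map_tnth_enum t) count_map.
by apply: eq_count.
Qed.

(** Disjoint blocks covering [n] amount to a function from elements to positions.
    Condition (a) holds for every admissible word because its first letter can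
    only be [None]. *)
Lemma OWPbar_words {R : realType} (c : R -> R) {n : nat} (y : R) : (1 <= n)%N ->
  \sum_(p in OWPbar n) OWP_weight c p y =
  \sum_(t : n.-tuple (block_pos n) | admissible t)
    \prod_(a | active n a) derive1n (count_mem a t) c y.
Proof.
move=> n_gt0.
pose h (t : n.-tuple (block_pos n)) : block_list n :=
  [ffun a => [set j | tnth t j == a]%SET].
pose h' (p : block_list n) : n.-tuple (block_pos n) :=
  [tuple odflt None [pick a | j \in p a] | j < n].
have hK : cancel h h'.
  move=> t; apply: eq_from_tnth => j; rewrite tnth_mktuple.
  case: pickP => [a|/(_ (tnth t j))]; first by rewrite ffunE inE => /eqP.
  by rewrite ffunE inE eqxx.
have h'K p : p \in OWPbar n -> h (h' p) = p.
  rewrite inE => /and4P[/'forall_forallP dis /eqP cov _ _].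
  apply/ffunP => a; apply/setP => j; rewrite ffunE inE tnth_mktuple.
  have : j \in (\bigcup_a p a)%SET by rewrite cov inE.
  case/bigcupP => b _ jb; case: pickP => [d jd|/(_ b)]; last by rewrite jb.
  have uniq_pos e : j \in p e -> e = b.
    move=> je; apply/eqP; case: (e =P b) => // /eqP eb.
    by have := dis e b; rewrite eb => /disjointFr /(_ je); rewrite jb.
  rewrite (uniq_pos d jd) /=; apply/eqP/idP => [<-//|ja].
  by rewrite (uniq_pos a ja).
rewrite (reindex_onto h h' h'K); apply: eq_big => [t|t _]; last first.
  apply: eq_big => [[[i b]|] //=|a _]; first by rewrite ltn_ord.
  by rewrite ffunE card_tnth_count.
rewrite hK eqxx andbT inE; apply/idP/idP.
  case/and4P => _ _ _ /'forall_forallP lt.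
  apply/allP => j; rewrite mem_iota size_tuple add0n => /andP[_ jn].
  have <- : tnth t (Ordinal jn) = nth None t j by exact: tnth_nth.
  case E : (tnth t (Ordinal jn)) => [[i b]|] //=.
  have /forallP/(_ (Ordinal jn)) := lt i b.
  by rewrite ffunE inE E eqxx.
move=> adm; have act (j : 'I_n) : active j (tnth t j).
  rewrite (tnth_nth None); apply: (allP adm).
  by rewrite mem_iota size_tuple add0n ltn_ord.
apply/and4P; split.
- apply/'forall_forallP => a b; apply/implyP => ab; rewrite -setI_eq0.
  by apply/eqP/setP => j; rewrite !ffunE !inE; case: eqP => // ->; exact: negbTE.
- by apply/eqP/setP => j; rewrite inE; apply/bigcupP; exists (tnth t j) => //; rewrite ffunE inE.
- apply/existsP; exists (Ordinal n_gt0); rewrite ffunE inE /lab /= eqxx andbT.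
  by have := act (Ordinal n_gt0); case: (tnth _ _) => [[i b]|].
- apply/'forall_forallP => i b; apply/forallP => j; apply/implyP.
  by rewrite ffunE inE => /eqP jE; have := act j; rewrite jE.
Qed.

(** * Expansion over words of columns *)

(** Letter [k] of a word of columns records that a block of size [k] has become a
    block of size [k + 1], that is, that a box has been added to the column with
    0-based index [k]. Along a lattice word, the blocks of size at least [k + 1]
    are then counted by [count_mem k], out of [2 * size w + 1] blocks in total. *)
Definition blocks_of_size (w : seq nat) (i : nat) : nat :=
  if i is k.+1 then (count_mem k w - count_mem i w)%N
  else ((size w).*2.+1 - count_mem 0%N w)%N.

(** Each step counts the blocks to which the prescribed increment applies. The
    product vanishes exactly when some step finds no such block, so that
    positivity of [num_growths w] says that [w] is a lattice word, the condition
    for the columns to form a Ferrers diagram at every stage. *)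
Definition num_growths (w : seq nat) : nat :=
  (\prod_(j < size w) blocks_of_size (take j w) (nth 0 w j))%N.

Lemma num_growths_rcons (w : seq nat) (k : nat) :
  num_growths (rcons w k) = (num_growths w * blocks_of_size w k)%N.
Proof.
rewrite /num_growths size_rcons big_ord_recr /= nth_rcons ltnn eqxx -cats1 take_size_cat //.
congr (_ * _)%N; apply: eq_bigr => j _.
by rewrite nth_cat ltn_ord takel_cat // ltnW.
Qed.

Lemma num_growths_take_gt0 {w : seq nat} (j : nat) :
  (0 < num_growths w)%N -> (0 < num_growths (take j w))%N.
Proof.
elim/last_ind: w => [//|w k IHw]; rewrite num_growths_rcons muln_gt0 => /andP[w0 wk].
have [jw|jw] := leqP j (size w); first by rewrite -cats1 takel_cat //; exact: IHw.
by rewrite take_oversize ?size_rcons // num_growths_rcons muln_gt0 w0.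
Qed.

(** The lattice condition: a step that would make column [k + 1] higher than column
    [k] finds no block of the required size, and annihilates the product. *)
Lemma count_mem_antitone {w : seq nat} {i k : nat} :
  (0 < num_growths w)%N -> (i <= k)%N -> (count_mem k w <= count_mem i w)%N.
Proof.
move=> w0; have le1 j : (count_mem j.+1 w <= count_mem j w)%N.
  elim/last_ind: w w0 => [//|w l IHw]; rewrite num_growths_rcons muln_gt0 => /andP[w0 wl].
  rewrite !count_mem_rcons; have := IHw w0; case: (l =P j.+1) wl => [-> /=|]; lia.
elim: k => [|k IHk]; first by case: i.
rewrite leq_eqVlt => /orP[/eqP->//|/IHk]; exact: leq_trans.
Qed.

(** A box in column [k] forces boxes in all previous columns. *)
Lemma mem_word_lt_size {w : seq nat} {k : nat} :
  (0 < num_growths w)%N -> k \in w -> (k < size w)%N.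
Proof.
elim/last_ind: w k => [//|w l IHw] k; rewrite num_growths_rcons muln_gt0 => /andP[w0 wl].
rewrite mem_rcons inE size_rcons ltnS => /predU1P[->|/(IHw k w0)/ltnW//].
case: l wl => [//|l] /=; rewrite subn_gt0 => wl; apply: IHw => //.
by rewrite -has_pred1 has_count; exact: leq_ltn_trans wl.
Qed.

(** Written additively because subtraction on [nat] is truncated: a block of size
    [k] is replaced by one of size [k + 1], and two empty blocks appear. *)
Lemma blocks_of_size_rcons {w : seq nat} {k : nat} (i : nat) :
  (0 < num_growths w)%N -> (0 < blocks_of_size w k)%N ->
  (blocks_of_size (rcons w k) i + (i == k) =
   blocks_of_size w i + (i == k.+1) + (i == 0) * 2)%N.
Proof.
move=> w0 wk; rewrite /blocks_of_size size_rcons !count_mem_rcons.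
case: i => [|i]; first by have := count_size (pred1 0%N) w; case: k wk => [|k] /=; lia.
rewrite !count_mem_rcons.
have := count_mem_antitone w0 (leqnSn i).
move: wk; rewrite /blocks_of_size; case: k => [|k] /=; last case: (k =P i) => [->|]; lia.
Qed.

Lemma prod_delta_exp {S : comNzRingType} {n : nat} (z : nat -> S) (k e : nat) :
  (k < n)%N -> \prod_(j < n) z j ^+ ((j == k :> nat) * e) = z k ^+ e.
Proof.
move=> kn; rewrite (bigD1 (Ordinal kn)) //= eqxx mul1n big1 ?mulr1 // => j.
by rewrite -(inj_eq val_inj) /= => /negbTE ->.
Qed.

(** The monomial after one step, in the form that the Leibniz rule produces. *)
Lemma prod_exp_step {S : comNzRingType} {n : nat} {z : nat -> S} {e e' : nat -> nat}
    {k : nat} (kn : (k < n)%N) : (0 < e k)%N ->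
  (forall i, e' i + (i == k) = e i + (i == k.+1) + (i == 0) * 2)%N ->
  \prod_(j < n.+1) z j ^+ e' j =
  z 0%N ^+ 2 * (z k ^+ (e k).-1 * z k.+1 *
    \prod_(j < n.+1 | j != widen_ord (leqnSn n) (Ordinal kn)) z j ^+ e j).
Proof.
move=> ek0 ee'.
(* As [e k > 0], the exponents [e'] split into natural numbers without truncation. *)
have -> : \prod_(j < n.+1) z j ^+ e' j =
    \prod_(j < n.+1) z j ^+ (e j - (j == k :> nat))%N *
    \prod_(j < n.+1) z j ^+ ((j == k.+1 :> nat) * 1)%N *
    \prod_(j < n.+1) z j ^+ ((j == 0 :> nat)%N * 2)%N.
  rewrite -!big_split /=; apply: eq_bigr => j _; rewrite -!exprD; congr (_ ^+ _).
  by have := ee' j; case: (nat_of_ord j =P k) => [->|_]; lia.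
rewrite !prod_delta_exp // expr1 mulrC; congr (_ * _).
rewrite (bigD1 (widen_ord (leqnSn n) (Ordinal kn))) //= eqxx subn1 -!mulrA; congr (_ * _).
rewrite mulrC; congr (_ * _); apply: eq_bigr => j; rewrite -(inj_eq val_inj) /=.
by move/negbTE ->; rewrite subn0.
Qed.

(** The same recursion as for words of positions, but with equal factors grouped
    into powers: differentiating [c_k ^ e_k] gives [e_k] equal terms, one for each
    of the [e_k] blocks of size [k]. *)
Lemma iter_c2D_columns {R : realType} {U : set R} {c : R -> R} {n m : nat} {y : R} :
  open U -> smooth_on U c -> (m <= n)%N -> U y ->
  iter m (c2D c) c y =
  \sum_(t : m.-tuple 'I_n | (0 < num_growths (map val t))%N)
    (num_growths (map val t))%:R * \prod_(i < n.+1) derive1n i c y ^+ blocks_of_size (map val t) i.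
Proof.
move=> oU hc; elim: m y => [|m IHm] y mn Uy.
  pose G (t : seq 'I_n) := (num_growths (map val t))%:R *
    \prod_(i < n.+1) derive1n i c y ^+ blocks_of_size (map val t) i.
  rewrite (@big_tuple0 _ _ (fun t => 0 < num_growths (map val t))%N G)
    /G /= /num_growths ?big_ord0 // mul1r.
  by rewrite big_ord_recl big1 ?mulr1.
rewrite (@big_tuple_rcons _ _ _ (fun t => 0 < num_growths (map val t))%N
  (fun t a => 0 < blocks_of_size (map val t) (val a))%N
  (fun t => (num_growths (map val t))%:R *
    \prod_(i < n.+1) derive1n i c y ^+ blocks_of_size (map val t) i)); last first.
  by move=> t a; rewrite map_rcons num_growths_rcons muln_gt0.
have {}IHm z : U z -> _ := IHm z (ltnW mn).
have der (t : m.-tuple 'I_n) : is_derive y 1 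
    (fun z => (num_growths (map val t))%:R *
       \prod_(i < n.+1) derive1n i c z ^+ blocks_of_size (map val t) i) _ :=
  is_deriveZ (num_growths (map val t))%:R (is_derive_prod (P := predT)
  (fun i : 'I_n.+1 => is_derive_exp (blocks_of_size (map val t) i) (is_derive_derive1n i hc Uy))).
rewrite iterS (c2D_eq_on oU IHm Uy (is_derive_sum_fin (fun t _ => der t))) {IHm der}.
rewrite big_distrr /=; apply: eq_bigr => t t0.
rewrite [RHS]big_mkcond big_ord_recr /=.
(* After [m < n] steps no block has reached size [n], so that the last factor
   contributes no letter. *)
have -> : blocks_of_size (map val t) n = 0%N.
  case: n mn t t0 => [//|n] mn t t0 /=; apply/eqP; rewrite subn_eq0.
  suff -> : count_mem n (map val t) = 0%N by [].
  apply/count_memPn; apply/negP => /(mem_word_lt_size t0).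
  by rewrite size_map size_tuple ltnNge -ltnS mn.
rewrite !mul0r addr0 /GRing.scale /= mulrCA !big_distrr /=.
apply: eq_bigr => k _; case: ltnP => [k0|]; last first.
  by rewrite leqn0 => /eqP ->; rewrite !mul0r !mulr0.
rewrite map_rcons num_growths_rcons natrM -!mulrA; congr (_ * _).
rewrite (prod_exp_step (z := fun i => derive1n i c y) (ltn_ord k) k0
  (fun i => blocks_of_size_rcons i t0 k0)).
have -> : Ordinal (ltn_ord k) = k by exact: val_inj.
by rewrite [in RHS]expr2 -!mulrA [RHS]mulrCA; congr (_ * _); exact: mulrCA.
Qed.

(** * Counting along prefixes and initial segments *)

Lemma sum_count_take {T : Type} (x0 : T) (a : pred T) (s : seq T) (i : nat) :
  count a (take i s) = (\sum_(j < size s) ((j < i)%N && a (nth x0 s j)))%N.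
Proof.
elim: s i => [|x s IHs] [|i]; rewrite ?big_ord0 //=; first by rewrite big1.
by rewrite big_ord_recl /= IHs; congr (_ + _)%N; apply: eq_bigr.
Qed.

Lemma leq_count_take {T : Type} (a : pred T) (s : seq T) {i j : nat} :
  (i <= j)%N -> (count a (take i s) <= count a (take j s))%N.
Proof.
case: s => [//|x s]; move: (x :: s) => {}s ij.
rewrite !(sum_count_take x); apply: leq_sum => l _.
by case: ltnP => //= li; rewrite (leq_trans li ij).
Qed.

Lemma count_mem_take_nth {T : eqType} (x0 : T) (s : seq T) (j : nat) : (j < size s)%N ->
  count_mem (nth x0 s j) (take j.+1 s) = (count_mem (nth x0 s j) (take j s)).+1.
Proof. by move=> js; rewrite (take_nth x0 js) count_mem_rcons eqxx addn1. Qed.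

(** The number of occurrences of [x] grows by steps of one along [s], hence takes
    every value below its final one. *)
Lemma ex_nth_count {T : eqType} (x0 x : T) (s : seq T) (r : nat) :
  (r < count_mem x s)%N ->
  exists2 j, (j < size s)%N & nth x0 s j = x /\ count_mem x (take j s) = r.
Proof.
elim/last_ind: s => [//|s y IHs]; rewrite count_mem_rcons size_rcons => rc.
have [/IHs[j js [sj cj]]|rs] := ltnP r (count_mem x s).
  by exists j; rewrite ?ltnS 1?ltnW // nth_rcons js -cats1 takel_cat // ltnW.
have /eqP yx : y == x by case: eqP rc => // _; rewrite addn0 ltnNge rs.
exists (size s) => //; rewrite nth_rcons ltnn eqxx -cats1 take_size_cat //; split=> //.
by move: rc; rewrite yx eqxx addn1 ltnS => rc; apply/eqP; rewrite eqn_leq rs rc.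
Qed.

(** An initial segment of the ordinals is determined by its cardinality. *)
Lemma ltn_card_antitone {n : nat} (P : pred nat) (k : nat) :
  (forall i j, (i <= j)%N -> P j -> P i) ->
  (k < #|[set i : 'I_n | P i]%SET|)%N = (k < n)%N && P k.
Proof.
move=> antiP; rewrite -sum1dep_card big_mkcond /=.
elim: n => [|n IHn]; first by rewrite big_ord0.
rewrite big_ord_recr /=; have [Pn|Pn] := boolP (P n).
  rewrite (eq_bigr (fun=> 1%N)) => [|i _].
    rewrite sum_nat_const card_ord muln1 addn1 ltnS.
    by case: leqP => //= kn; rewrite (antiP _ _ kn Pn).
  by rewrite (antiP _ _ (ltnW (ltn_ord i)) Pn).
rewrite addn0 IHn ltnS (leq_eqVlt k n); case: eqP => [->|//] /=.
by rewrite (negbTE Pn) !andbF.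
Qed.

Lemma card_ord_lt {n b : nat} : (b <= n)%N -> #|[set i : 'I_n | (i < b)%N]%SET| = b.
Proof.
move=> bn; set m := #|_|.
have ltm k : (k < m)%N = (k < n)%N && (k < b)%N.
  by apply: (ltn_card_antitone (fun i => i < b)%N) => i j; exact: leq_ltn_trans.
apply/eqP; rewrite eqn_leq; apply/andP; split; rewrite leqNgt.
  by rewrite ltm ltnn andbF.
apply/negP => mb.
by have := ltm m; rewrite ltnn mb (leq_trans mb bn).
Qed.

Lemma eq_lift0 {n : nat} (a : 'I_n.+1) (j : 'I_n) :
  (a == lift ord0 j) = (a == j.+1 :> nat).
Proof. by rewrite -(lift0 j). Qed.

(** * The filling attached to a word of columns *)

Lemma nth_cols {n : nat} (t : n.-tuple 'I_n) (j : 'I_n) :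
  nth 0%N (map val t) j = tnth t j.
Proof. by rewrite (nth_map j) ?size_tuple ?ltn_ord // -tnth_nth. Qed.

Lemma size_cols {n : nat} (t : n.-tuple 'I_n) : size (map val t) = n.
Proof. by rewrite size_map size_tuple. Qed.

Lemma count_cols_take {n : nat} (t : n.-tuple 'I_n) (i k : nat) :
  count_mem k (take i (map val t)) =
  #|[set j : 'I_n | (j < i)%N && (tnth t j == k :> nat)]%SET|.
Proof.
rewrite (sum_count_take 0%N) size_cols -sum1dep_card [RHS]big_mkcond /=.
by apply: eq_bigr => j _; rewrite nth_cols; case: (_ && _).
Qed.

Lemma cell_row_subproof {n : nat} (t : n.-tuple 'I_n) (j : 'I_n) :
  (count_mem (val (tnth t j)) (take j (map val t)) < n)%N.
Proof.
apply: leq_ltn_trans (count_size _ _) _.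
by rewrite size_take size_cols ltn_ord ltn_ord.
Qed.

(** Entry [lab j] goes on top of its column, hence in the row whose 0-based index
    is the number of earlier entries of that column. *)
Definition cell {n : nat} (t : n.-tuple 'I_n) (j : 'I_n) : 'I_n * 'I_n :=
  (Ordinal (cell_row_subproof t j), tnth t j).

Lemma count_take_cellS {n : nat} (t : n.-tuple 'I_n) (j : 'I_n) :
  count_mem (val (tnth t j)) (take j.+1 (map val t)) = (cell t j).1.+1.
Proof. by have := count_mem_take_nth 0%N (map val t) j; rewrite size_cols nth_cols; apply. Qed.

Lemma cell_row_ltn {n : nat} (t : n.-tuple 'I_n) (i j : 'I_n) :
  tnth t i = tnth t j -> (i < j)%N ->
  ((cell t i).1 < (cell t j).1)%N.
Proof. by move=> tij ij; rewrite -count_take_cellS /= tij; exact: leq_count_take. Qed.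

Lemma cell_inj {n : nat} (t : n.-tuple 'I_n) : injective (cell t).
Proof.
move=> i j cij; have tij : tnth t i = tnth t j := congr1 snd cij.
have := congr1 (fun x => val x.1) cij; rewrite /= => rij.
apply/val_inj; case: (ltngtP i j) => // lt_ij.
  by have := cell_row_ltn _ _ _ tij lt_ij; rewrite /= rij ltnn.
by have := cell_row_ltn _ _ _ (esym tij) lt_ij; rewrite /= rij ltnn.
Qed.

(** [T] is the filling that results from placing the entries according to [t]. Both
    directions of the correspondence with tableaux, and the comparison of weights,
    are derived from this relation. *)
Definition fills {n : nat} (t : n.-tuple 'I_n) (T : filling n) :=
  forall x (j : 'I_n), (T x == j.+1 :> nat) = (cell t j == x).

Definition fill {n : nat} (t : n.-tuple 'I_n) : filling n :=
  [ffun x => if [pick j | cell t j == x] is Some j then lift ord0 j else ord0].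

Lemma fills_fill {n : nat} (t : n.-tuple 'I_n) : fills t (fill t).
Proof.
move=> x j; rewrite ffunE; case: pickP => [i /eqP <-|/(_ j) ->//].
by rewrite lift0 eqSS (inj_eq (cell_inj t)) eq_sym.
Qed.

Definition entry_pos {n : nat} (T : filling n) (j : 'I_n) : 'I_n * 'I_n :=
  odflt (j, j) [pick x | T x == j.+1 :> nat].

Definition column_word {n : nat} (T : filling n) : n.-tuple 'I_n :=
  [tuple (entry_pos T j).2 | j < n].

Lemma column_word_fills {n : nat} {t : n.-tuple 'I_n} {T : filling n} :
  fills t T -> column_word T = t.
Proof.
move=> tT; apply: eq_from_tnth => j; rewrite tnth_mktuple /entry_pos.
case: pickP => [x|/(_ (cell t j))]; rewrite tT ?eqxx //.
by move/eqP <-.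
Qed.

Lemma box_entry {n : nat} {T : filling n} {x : 'I_n * 'I_n} :
  is_box T x -> exists j : 'I_n, T x = j.+1 :> nat.
Proof.
rewrite /is_box; case: (T x) => -[//|j] /= jn _.
by exists (Ordinal (n := n) (m := j) jn).
Qed.

Lemma fills_inj {n : nat} {t : n.-tuple 'I_n} {T T' : filling n} :
  fills t T -> fills t T' -> T = T'.
Proof.
move=> tT tT'; apply/ffunP => x; apply/val_inj => /=.
have [|] := boolP (is_box T x).
  by case/box_entry => j Tx; apply/esym/eqP; rewrite Tx tT' -tT Tx.
rewrite /is_box -eqn0Ngt => /eqP T0; rewrite T0; apply/esym/eqP.
rewrite eqn0Ngt; apply/negP => /box_entry[j /eqP].
by rewrite tT' -tT T0.
Qed.

Lemma fills_cell {n : nat} {t : n.-tuple 'I_n} {T : filling n} :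
  fills t T -> forall j : 'I_n, T (cell t j) = j.+1 :> nat.
Proof. by move=> tT j; apply/eqP; rewrite tT. Qed.

Lemma fills_boxP {n : nat} {t : n.-tuple 'I_n} {T : filling n} :
  fills t T -> forall x, is_box T x -> exists j, cell t j = x.
Proof. by move=> tT x /box_entry[j /eqP]; rewrite tT => /eqP; exists j. Qed.

Lemma card_boxes {n : nat} {t : n.-tuple 'I_n} {T : filling n}
    (Q : pred ('I_n * 'I_n)) :
  fills t T ->
  #|[set x | is_box T x && Q x]%SET| = #|[set j | Q (cell t j)]%SET|.
Proof.
move=> tT; rewrite -(card_imset _ (cell_inj t)); apply: eq_card => x; rewrite inE.
apply/andP/imsetP => [[Tx Qx]|[j]].
  by have [j jx] := fills_boxP tT _ Tx; exists j; rewrite ?inE jx.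
by rewrite inE => Qj ->; rewrite /is_box (fills_cell tT).
Qed.

Lemma fills_box {n : nat} {t : n.-tuple 'I_n} {T : filling n} :
  fills t T -> forall r k,
  is_box T (r, k) = (r < count_mem (val k) (map val t))%N.
Proof.
move=> tT r k; apply/idP/idP.
  case/(fills_boxP tT) => j [<- <-] /=.
  rewrite -[map val t in X in (_ < X)%N]take_size -count_take_cellS.
  by apply: leq_count_take; rewrite size_cols.
case/(ex_nth_count 0%N) => j; rewrite size_cols => jn [tj cj].
have : cell t (Ordinal jn) = (r, k).
  have tjk : tnth t (Ordinal jn) = k by apply: val_inj; rewrite -tj; exact/esym/(nth_cols t (Ordinal jn)).
  by congr pair => //; apply: val_inj; rewrite /= tjk.
by move=> <-; rewrite /is_box (fills_cell tT).
Qed.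

(** * Standard Young tableaux as lattice words *)

(** Rows and columns of a diagram are conjugate to each other. *)
Lemma row_size_gt {n : nat} {t : n.-tuple 'I_n} {T : filling n} :
  fills t T -> (0 < num_growths (map val t))%N ->
  forall (r : 'I_n) k, (k < row_size T r)%N = (r < count_mem k (map val t))%N.
Proof.
move=> tT t0 r k.
have -> : row_size T r = #|[set k : 'I_n | (r < count_mem (k : nat) (map val t))%N]%SET|.
  by apply: eq_card => l; rewrite !inE (fills_box tT).
rewrite (ltn_card_antitone (fun k => r < count_mem k (map val t))%N); last first.
  by move=> i j ij rj; exact: leq_trans rj (count_mem_antitone t0 ij).
case: ltnP => //= nk; apply/esym/negbTE; rewrite -leqNgt.
suff -> : count_mem k (map val t) = 0%N by [].
apply/count_memPn; apply/negP => /mapP[j _ kj].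
by move: nk; rewrite kj leqNgt ltn_ord.
Qed.

(** The statistics of the tableau read on its word: columns of [T_i] are counts in
    prefixes, the rows with [i] boxes are the blocks of size [i], and [delta_i] is
    the number of blocks available at step [i]. In the first column the available
    blocks are the empty ones, [2 (i - 1) + 1 - (col_1(T_i) - 1)] in number; in
    column [k + 1] they are those of size [k], [col_k(T_i) - (col_(k+1)(T_i) - 1)]
    in number. *)
Lemma SYT_term_fills {R : realType} {c : R -> R} {y : R} {n : nat}
    {t : n.-tuple 'I_n} {T : filling n} :
  fills t T -> (0 < num_growths (map val t))%N ->
  SYT_term c T y =
  (num_growths (map val t))%:R *
    \prod_(i < n.+1) derive1n i c y ^+ blocks_of_size (map val t) i.
Proof.
move=> tT t0; have rowsP := row_size_gt tT t0.
have count_le k : (count_mem k (map val t) <= n)%N.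
  by apply: leq_trans (count_size _ _) _; rewrite size_cols.
have card_rows k : #|[set r | (k < row_size T r)%N]%SET| = count_mem k (map val t).
  rewrite -[RHS](card_ord_lt (count_le k)); apply: eq_card => r.
  by rewrite !inE rowsP.
have rows_blocks i : rows_of_size i.+1 T = blocks_of_size (map val t) i.+1.
  rewrite /= -!card_rows -cardsDS; last first.
    by apply/fintype.subsetP => r; rewrite !inE; exact: ltnW.
  by apply: eq_card => r; rewrite !inE -leqNgt eqn_leq andbC.
have col_sizeE i (k : 'I_n) :
    col_size k.+1 (entries_le i T) = count_mem (k : nat) (take i (map val t)).
  rewrite count_cols_take.
  have -> : col_size k.+1 (entries_le i T) =
      #|[set x | is_box T x && ((T x <= i)%N && (x.2 == k :> nat))]%SET|.
    apply: eq_card => x; rewrite !inE /is_box ffunE /lab eqSS.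
    by case: (leqP (T x) i) => _ /=; rewrite ?andbF.
  rewrite (card_boxes _ tT); apply: eq_card => j.
  by rewrite !inE (fills_cell tT).
have deltaE (j : 'I_n) : delta j.+1 T =
    (blocks_of_size (take j (map val t)) (nth 0%N (map val t) j))%:Z.
  have t0j := num_growths_take_gt0 j t0.
  rewrite /delta; have -> : col_of j.+1 T = (tnth t j).+1.
    rewrite /col_of; case: pickP => [x /andP[_]|/(_ (cell t j))].
      by rewrite tT => /eqP <-.
    by rewrite /is_box (fills_cell tT) eqxx.
  rewrite nth_cols eqSS /= -[map (@nat_of_ord n) t]/(map val t).
  have colE := count_take_cellS t j.
  have colj : count_mem (val (tnth t j)) (take j (map val t)) = (cell t j).1 by [].
  have sizej : size (take j (map val t)) = j by rewrite size_takel // size_cols ltnW.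
  case: eqP => [tj|]; last first.
    case E : (nat_of_ord (tnth t j)) => [//|k] _; rewrite /blocks_of_size.
    have kn : (k < n)%N by rewrite ltnW // -E.
    have left_col : col_size k.+1 (entries_le j.+1 T) = count_mem k (take j (map val t)).
      rewrite (col_sizeE _ (Ordinal kn)) /= (take_nth 0%N) ?size_cols //.
      by rewrite count_mem_rcons nth_cols E gtn_eqF // addn0.
    have own_col : col_size k.+2 (entries_le j.+1 T) = (cell t j).1.+1.
      by rewrite -E col_sizeE.
    rewrite left_col own_col.
    have own_row : count_mem k.+1 (take j (map val t)) = (cell t j).1 by rewrite -E.
    by have := count_mem_antitone t0j (leqnSn k); rewrite own_row; lia.
  rewrite /blocks_of_size tj sizej -tj col_sizeE colE.
  have := count_size (pred1 (val (tnth t j))) (take j (map val t)).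
  by rewrite sizej -[nat_of_ord _]/(val _) colj; lia.
rewrite /SYT_term big_split /= -mulrA; congr (_ * _).
  rewrite big_add1 big_mkord /num_growths size_cols natr_prod.
  by apply: eq_bigr => j _; rewrite deltaE.
rewrite big_add1 big_mkord [RHS]big_ord_recl mulrC; congr (_ * _).
  by rewrite /= size_cols /num_rows card_rows mul2n addn1.
by apply: eq_bigr => j _; rewrite rows_blocks lift0.
Qed.

(** Columns increase because entries are stacked in order; rows increase because, by
    the lattice condition on prefixes, the height [r + 1] is reached in a column
    no earlier than in the columns to its left. *)
Lemma fill_SYT {n : nat} (t : n.-tuple 'I_n) :
  (0 < num_growths (map val t))%N -> fill t \in SYT n.
Proof.
move=> t0; set T := fill t; have tT : fills t T := fills_fill t.
have rowsP := row_size_gt tT t0.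
have row_le r : (row_size T r < n.+1)%N by rewrite ltnS -[X in (_ <= X)%N]card_ord max_card.
rewrite inE; apply/existsP; exists [ffun r => Ordinal (row_le r)].
apply/andP; split; [apply/andP; split|apply/and4P; split].
- apply/eqP; under eq_bigr do rewrite ffunE /=.
  transitivity #|[set x | is_box T x && true]%SET|.
    rewrite -sum1dep_card; under eq_bigr do rewrite /row_size -sum1dep_card.
    by rewrite pair_big_dep /=; apply: eq_bigl => -[r k]; rewrite andbT.
  by rewrite (card_boxes xpredT tT) -[RHS](card_ord n); apply: eq_card => j; rewrite !inE.
- apply/'forall_forallP => r s; apply/implyP => rs; rewrite !ffunE /=.
  rewrite leqNgt; apply/negP; rewrite rowsP => lt_s.
  by have := leq_ltn_trans rs lt_s; rewrite -rowsP ltnn.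
- by apply/'forall_forallP => r k; rewrite ffunE /lab /= rowsP (fills_box tT).
- apply/forallP => i; apply/implyP; case: (unliftP ord0 i) => [j ->|->//] _.
  rewrite (_ : [set x | T x == lift ord0 j]%SET = [set cell t j]%SET) ?cards1 //.
  by apply/setP => x; rewrite !inE eq_lift0 tT eq_sym.
- apply/'forall_forallP => r k; apply/forallP => k'; apply/implyP => /and3P[Trk Trk' kk'].
  have [j jx] := fills_boxP tT _ Trk; have [j' jx'] := fills_boxP tT _ Trk'.
  rewrite -jx -jx' !(fills_cell tT) ltnS ltnNge; apply/negP; rewrite leq_eqVlt.
  case/predU1P => [/val_inj jj'|j'j].
    by move: kk'; have := jx; rewrite -jj' jx' => -[->]; rewrite ltnn.
  have rE : (cell t j).1 = r := congr1 fst jx.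
  have kE : tnth t j = k := congr1 snd jx.
  have rE' : (cell t j').1 = r := congr1 fst jx'.
  have kE' : tnth t j' = k' := congr1 snd jx'.
  have := count_mem_antitone (num_growths_take_gt0 j'.+1 t0) (ltnW kk').
  have -> : count_mem (k' : nat) (take j'.+1 (map val t)) = r.+1.
    by rewrite -kE' count_take_cellS rE'.
  apply/negP; rewrite -ltnNge ltnS -rE -kE.
  exact: leq_count_take.
- apply/'forall_forallP => k r; apply/forallP => r'; apply/implyP => /and3P[Trk Trk' rr'].
  have [j jx] := fills_boxP tT _ Trk; have [j' jx'] := fills_boxP tT _ Trk'.
  rewrite -jx -jx' !(fills_cell tT) ltnS ltnNge; apply/negP; rewrite leq_eqVlt.
  have tjj' : tnth t j' = tnth t j by rewrite -[LHS]/(cell t j').2 -[RHS]/(cell t j).2 jx jx'.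
  case/predU1P => [/val_inj jj'|j'j].
    by move: rr'; have := jx; rewrite -jj' jx' => -[->]; rewrite ltnn.
  by have := cell_row_ltn _ _ _ tjj' j'j; rewrite jx jx' /= ltnNge (ltnW rr').
Qed.

(** Conversely, below a box of a tableau its column contains exactly the smaller
    entries of that column, so the row index counts the earlier occurrences of the
    same letter; and the left neighbour of a box holds a smaller entry, which is
    the lattice condition. *)
Lemma SYT_fills {n : nat} {T : filling n} : T \in SYT n ->
  fills (column_word T) T /\ (0 < num_growths (map val (column_word T)))%N.
Proof.
rewrite inE => /existsP[lam /andP[/andP[_ /'forall_forallP lam_decr]]].
case/and4P => /'forall_forallP boxP /forallP uniqT /'forall_forallP rowP /'forall_forallP colP.
set t := column_word T.
have uniq_entry x x' (j : 'I_n) : T x = j.+1 :> nat -> T x' = j.+1 :> nat -> x = x'.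
  move=> Tx Tx'; have := uniqT (lift ord0 j); rewrite lift0 /= => /cards1P[z Tz].
  have eqz w : T w = j.+1 :> nat -> w = z.
    by move=> Tw; apply/set1P; rewrite -Tz inE eq_lift0 Tw.
  by rewrite (eqz x) // (eqz x').
have T_pos (j : 'I_n) : T (entry_pos T j) = j.+1 :> nat.
  rewrite /entry_pos; case: pickP => [x /eqP//|no].
  have := uniqT (lift ord0 j); rewrite lift0 /= => /cards1P[z Tz].
  have := set11 z; rewrite -Tz inE eq_lift0.
  by have /= -> := no z.
have box_below (r r' k k' : 'I_n) : (r' <= r)%N -> (k' <= k)%N ->
    is_box T (r, k) -> is_box T (r', k').
  move=> rr kk; rewrite (eqP (boxP r k)) (eqP (boxP r' k')) /lab => kr.
  apply: leq_trans (leq_trans kr _); first exact: kk.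
  by apply: (implyP (lam_decr r' r)).
have tE j : tnth t j = (entry_pos T j).2 by rewrite tnth_mktuple.
have count_row (j r k : 'I_n) : T (r, k) = j.+1 :> nat ->
    count_mem (val k) (take j (map val t)) = r.
  move=> Tx; rewrite count_cols_take -[RHS](card_ord_lt (ltnW (ltn_ord r))).
  have box_x : is_box T (r, k) by rewrite /is_box Tx.
  (* The earlier entries of column [k] occupy exactly the rows below [r]. *)
  rewrite -(card_in_imset (f := fun i => (entry_pos T i).1)); last first.
    move=> i i'; rewrite !inE !tE => /andP[_ /eqP/val_inj ik] /andP[_ /eqP/val_inj i'k] rr.
    apply: val_inj; apply: succn_inj; rewrite -!T_pos.
    by congr (nat_of_ord (T _)); apply/eqP; rewrite -pair_eqE /= rr ik i'k !eqxx.
  apply: eq_card => s; rewrite inE; apply/imsetP/idP.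
    case=> i; rewrite inE tE => /andP[ij /eqP/val_inj ik] ->.
    have Ti := T_pos i; rewrite ltnNge leq_eqVlt; apply/negP.
    have eqi : entry_pos T i = ((entry_pos T i).1, k) by rewrite -ik; case: (entry_pos T i).
    case/predU1P => [/val_inj re|rlt].
      by move: Ti; rewrite eqi -re Tx => -[ji]; move: ij; rewrite ji ltnn.
    have /forallP/(_ (entry_pos T i).1)/implyP := colP k r; rewrite box_x rlt -eqi /= andbT.
    by rewrite /is_box Ti Tx => /(_ isT); rewrite ltnS ltnNge (ltnW ij).
  move=> sr; have box_s := box_below r s k k (ltnW sr) (leqnn k) box_x.
  have [i Ti] := box_entry box_s.
  have posi : entry_pos T i = (s, k) := uniq_entry _ _ _ (T_pos i) Ti.
  exists i; last by rewrite posi.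
  rewrite inE tE posi eqxx andbT -ltnS -Ti -Tx.
  have /forallP/(_ r)/implyP := colP k s; rewrite box_x box_s sr; exact.
have tT : fills t T.
  have cellT (j : 'I_n) x : T x = j.+1 :> nat -> cell t j = x.
    move=> Tx; have xE : entry_pos T j = x := uniq_entry _ _ _ (T_pos j) Tx.
    case: x Tx xE => r k Tx xE; have tj : tnth t j = k by rewrite tE xE.
    by congr pair => //; apply: val_inj; rewrite /= tj; exact: count_row Tx.
  move=> x j; apply/eqP/eqP => [/cellT //|<-].
  by rewrite (cellT _ _ (T_pos j)) T_pos.
split=> //; rewrite /num_growths prodn_gt0 // => -[j js].
have jn : (j < n)%N by rewrite -(size_cols t).
rewrite -[nat_of_ord (Ordinal js)]/(nat_of_ord (Ordinal jn)).
move: (Ordinal jn) => {js jn}j; rewrite nth_cols /blocks_of_size.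
have sizej : size (take j (map val t)) = j by rewrite size_takel // size_cols ltnW.
case E : (nat_of_ord (tnth t j)) => [|k].
  have := count_size (pred1 0%N) (take j (map val t)).
  by rewrite sizej; lia.
have kn : (k < n)%N by rewrite ltnW // -E.
rewrite subn_gt0.
have -> : count_mem k.+1 (take j (map val t)) = (cell t j).1 by rewrite -E.
set r := (cell t j).1.
have Tj : T (r, tnth t j) = j.+1 :> nat := fills_cell tT j.
(* The left neighbour of entry [lab j] is an earlier entry, in the same row. *)
have box_rk : is_box T (r, Ordinal kn).
  by apply: (box_below r r (tnth t j)); rewrite // /is_box ?Tj // E.
have [i Ti] := box_entry box_rk.
have ij : (i < j)%N.
  have /forallP/(_ (tnth t j))/implyP := rowP r (Ordinal kn).
  by rewrite box_rk /is_box Tj Ti E /= ltnS; apply.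
have ci : cell t i = (r, Ordinal kn) by apply/eqP; rewrite -tT Ti.
have <- : count_mem k (take i.+1 (map val t)) = r.+1.
  have ti : tnth t i = Ordinal kn := congr1 snd ci.
  by rewrite -[k]/(val (Ordinal kn)) -ti count_take_cellS ci.
exact: leq_count_take.
Qed.

Theorem theorem42 (R : realType) (U : set R) (c : R -> R) (n : nat)
    (hU : open U) (hc : smooth_on U c) (hn : (1 <= n)%N) :
  (forall x : R, U x ->
     iter n (c2D c) c x = \sum_(p in OWPbar n) OWP_weight c p x) /\
  (forall x : R, U x ->
     iter n (c2D c) c x = \sum_(T in SYT n) SYT_term c T x).
Proof.
split=> y Uy; first by rewrite (OWPbar_words c y hn) -(iter_c2D_words hU hc).
rewrite (iter_c2D_columns hU hc (leqnn n) Uy).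
rewrite (reindex_onto fill column_word); last first.
  by move=> T /SYT_fills[tT _]; exact: fills_inj (fills_fill _) tT.
apply: eq_big => [t|t t0]; last by rewrite (SYT_term_fills (fills_fill t)).
rewrite (column_word_fills (fills_fill t)) eqxx andbT.
apply/idP/idP => [/fill_SYT //|/SYT_fills[_]].
by rewrite (column_word_fills (fills_fill t)).
Qed.
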